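(* Let $n,M$ be integers with $0\le n<M<\infty$, let $t>0$, and put $$R_{n,M}(t)=\mathcal I_n(t)+i^{\,n-1}\sum_{l=\lceil n/2\rceil}^{\lfloor (M-1)/2\rfloor}\frac{(2l-1)!!}{t^{2l-n+1}},$$ where $(-1)!!=1$ and an empty sum is $0$. Then $$|R_{n,M}(t)|\le \sqrt{\pi/2}\;\frac{1}{t^{M-n}}\;2^{M/2}\;\Gamma(1+M/2).$$
   Context: $\Gamma$ is the Euler gamma function and $i$ is the imaginary unit. $H\!e_n$ are the Hermite polynomials $H\!e_n(\omega)=(-1)^n e^{\omega^2/2}\frac{d^n}{d\omega^n}e^{-\omega^2/2}$, and $$\mathcal I_n(t)=\int_0^\infty H\!e_n(\omega)\,e^{-\omega^2/2}\exp(it\omega)\,d\omega .$$ *)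

(* Defs.v *)
From HB Require Import structures.
From mathcomp Require Import all_boot all_order all_algebra.
From mathcomp Require Import all_classical all_reals all_analysis.
From mathcomp Require Import complex.

Set Implicit Arguments.
Unset Strict Implicit.
Unset Printing Implicit Defensive.

Import Order.TTheory GRing.Theory Num.Theory.
Import numFieldNormedType.Exports.

Local Open Scope classical_set_scope.
Local Open Scope ring_scope.
Local Open Scope complex_scope.

Definition hermite_He (R : realType) (n : nat) (w : R) : R :=
  (-1) ^+ n * expR (w ^+ 2 / 2) *
    derive1n n (fun x : R => expR (- (x ^+ 2 / 2))) w.

Definition cexp (R : realType) (z : R[i]) : R[i] :=
  (expR (complex.Re z))%:C *
    (cos (complex.Im z) +i* sin (complex.Im z)).

(* Lebesgue integral of a complex-valued function, taken componentwise. *)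
Definition cintegral (R : realType) (D : set R) (f : R -> R[i]) : R[i] :=
  (\int[@lebesgue_measure R]_(x in D) complex.Re (f x))
  +i* (\int[@lebesgue_measure R]_(x in D) complex.Im (f x)).

Definition hermite_integral (R : realType) (n : nat) (t : R) : R[i] :=
  cintegral `[0, +oo[
    (fun w : R => (hermite_He n w * expR (- (w ^+ 2 / 2)))%:C
                  * cexp ('i * t%:C * w%:C)).

(* Euler's integral: the Gamma function at real a > 0; for a <= 0 the integral
   diverges and the value is junk. *)
Definition Gamma (R : realType) (a : R) : R :=
  \int[@lebesgue_measure R]_(x in `]0, +oo[) (x `^ (a - 1) * expR (- x)).

(* (2 l - 1)!! = 1 * 3 * ... * (2 l - 1); the empty product at l = 0 is the
   convention (-1)!! = 1. *)
Definition odd_dfact (l : nat) : nat := (\prod_(k < l) k.*2.+1)%N.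

(* The sum runs over ceil(n/2) <= l <= floor((M-1)/2), and is empty when the
   lower bound exceeds the upper one.  There 2 l >= n, and M >= 1 is intended,
   so no natural subtraction is truncated. *)
Definition hermite_remainder (R : realType) (n M : nat) (t : R) : R[i] :=
  hermite_integral n t +
  'i ^ (n%:Z - 1) *
    (\sum_(uphalf n <= l < (M.-1)./2.+1)
       (odd_dfact l)%:R / t ^+ (l.*2 - n + 1))%:C.

(* Main.v *)
Require Import Defs.
From mathcomp Require Import all_boot all_order all_algebra.
From mathcomp Require Import all_classical all_reals all_analysis.
From mathcomp Require Import measurable_realfun complex.
From mathcomp Require Import ring lra zify.
Import Order.TTheory GRing.Theory Num.Theory.
Import numFieldNormedType.Exports.
Local Open Scope ring_scope.

(** The proof is repeated integration by parts.  Write [g w] for the Gaussian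
    [expR (- (w ^+ 2 / 2))] and [K n] for [hermite_integral n t].  The Hermite
    polynomial [H n] satisfies [(H n * g)' = - H n.+1 * g], so integrating the
    derivative of [H n * g * exp(i t w)] over the half-line gives
    [K n.+1 = H n (0) + i t K n] ([hermite_integralS]).  Solving for [K n] and
    iterating up to [M] gives [K M / (i t) ^ (M - n)] minus the boundary terms
    [H k (0) / (i t) ^ (k - n + 1)]; those with [k] odd vanish, and the one with
    [k = 2 l] is the [l]-th term of the sum that the remainder adds to [K n],
    since [H (2 l) (0) = (-1) ^ l (2 l - 1)!!].  Hence the remainder is exactly
    [K M / (i t) ^ (M - n)] ([hermite_remainder_eq]), and it remains to bound
    [K M].

    By the Cauchy-Schwarz inequality, [|K M|] is at most the geometric mean of the
    half-line integrals of [H M ^ 2 * g] and of [g], which are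
    [M! sqrt (pi / 2)] and [sqrt (pi / 2)]: orthogonality of the Hermite
    polynomials survives on the half-line for consecutive indices, because
    [H n (0) * H n.+1 (0) = 0].  So [|K M| <= sqrt (pi / 2) sqrt M!]
    ([norm_hermite_integral_le]).

    Finally [M! <= (2 ^ (M / 2) Gamma (1 + M / 2)) ^ 2] ([fact_le_Gamma_sqr]):
    passing from [M] to [M + 2] multiplies the left side by [(M + 1) (M + 2)]
    and the right side by [(M + 2) ^ 2]; the starting cases are [M = 0] and
    [M = 1], the latter being [Gamma (3 / 2) ^ 2 >= 1 / 2].

    Every improper integral met here is that of a continuous function bounded by
    a multiple of [expR (- (x / 2))], and all of them are evaluated by a single
    form of the fundamental theorem of calculus
    ([Rintegral_deriv_exp_small]). *)

(** * Integration over the half-line under exponential decay *)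

Section ExpSmall.
Local Open Scope classical_set_scope.
Context {R : realType}.
Implicit Types (f F : R -> R).
Notation mu := (@lebesgue_measure R).

Lemma is_derive_continuous f (x df : R) :
  is_derive x 1 f df -> {for x, continuous f}.
Proof.
move=> fdf; apply: differentiable_continuous; apply/derivable1_diffP.
exact: ex_derive.
Qed.

Lemma is_derive_mulrl (a x : R) : is_derive x 1 (fun y => a * y) a.
Proof.
have := @is_deriveZ _ _ _ _ a _ _ _ (is_derive_id x 1).
by rewrite /GRing.scale/= mulr1.
Qed.

(** The rate [1 / 2] is slow enough to absorb any polynomial factor both against
    the Gaussian and against [expR (- x)]. *)
Definition exp_small f :=
  exists C : R, forall x, 0 <= x -> `|f x| <= C * expR (- (x / 2)).

Lemma exp_smallD f1 f2 : exp_small f1 -> exp_small f2 ->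
  exp_small (fun x => f1 x + f2 x).
Proof.
move=> [C1 h1] [C2 h2]; exists (C1 + C2) => x x0.
by rewrite mulrDl (le_trans (ler_normD _ _))// lerD// ?h1 ?h2.
Qed.

Lemma exp_smallM_bounded f1 f2 (B : R) :
  (forall x, `|f1 x| <= B) -> exp_small f2 ->
  exp_small (fun x => f1 x * f2 x).
Proof.
move=> h1 [C2 h2]; exists (B * C2) => x x0.
by rewrite normrM -mulrA ler_pM// ?h2.
Qed.

Lemma exp_smallZ (a : R) f : exp_small f -> exp_small (fun x => a * f x).
Proof. exact: exp_smallM_bounded. Qed.

Lemma exp_smallN f : exp_small f -> exp_small (fun x => - f x).
Proof. by move=> [C h]; exists C => x x0; rewrite normrN h. Qed.

Lemma cvg_expR_half : expR (- (x / 2)) @[x --> +oo%R] --> (0 : R).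
Proof.
apply: (@cvg_comp _ _ _ (fun x : R => x / 2) (fun x => expR (- x)) _
  (pinfty_nbhs R)).
  by apply: gt0_cvgMly => //; rewrite invr_gt0.
exact: cvgr_expR.
Qed.

Lemma exp_small_cvg0 f : exp_small f -> f x @[x --> +oo%R] --> (0 : R).
Proof.
move=> [C h]; apply/norm_cvg0P.
apply: (@squeeze_cvgr _ _ _ _ (cst 0) (fun x => C * expR (- (x / 2)))).
- near=> x; rewrite normr_ge0/= h//.
- exact: cvg_cst.
- by rewrite -(mulr0 C); apply: cvgM; [exact: cvg_cst|exact: cvg_expR_half].
Unshelve. all: end_near. Qed.

Lemma continuous_expR_half : continuous (fun x : R => expR (- (x / 2))).
Proof.
move=> x; apply: continuous_comp; last exact: continuous_expR.
by apply: cvgN; apply: cvgM; [exact: cvg_id|exact: cvg_cst].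
Qed.

Lemma is_derive_expR_half (x : R) :
  is_derive x 1 (fun x : R => - (2 * expR (- (x / 2)))) (expR (- (x / 2))).
Proof.
have h : is_derive x 1 (fun y : R => - (y / 2)) (- 2^-1).
  rewrite (_ : (fun y => _) = (- 2^-1) \*: (@id R)); last first.
    by apply/funext => y; rewrite /= /GRing.scale /=; lra.
  by apply: is_derive_eq; rewrite /GRing.scale/= mulr1.
have := @is_derive1_comp _ expR _ x _ _ (is_derive_expR _) h.
move=> /(@is_deriveZ _ _ _ _ (-2)) /is_derive_eq H.
rewrite (_ : (fun y => _) = (-2) \*: (expR \o (fun y : R => - (y / 2)))); last first.
  by apply/funext => y; rewrite /= /GRing.scale /=; lra.
by apply: H; rewrite /GRing.scale/=; lra.
Qed.

Lemma integral_expR_half :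
  (\int[mu]_(x in `[0%R, +oo[) (expR (- (x / 2)))%:E = 2%:E)%E.
Proof.
rewrite (@ge0_continuous_FTC2y _ _ (fun x : R => - (2 * expR (- (x / 2)))) _ 0).
- by rewrite mul0r oppr0 expR0 mulr1 sub0e -EFinN opprK.
- by move=> x _; exact: expR_ge0.
- by apply: continuous_subspaceT; exact: continuous_expR_half.
- rewrite -oppr0 -(mulr0 2); apply: cvgN; apply: cvgM; first exact: cvg_cst.
  exact: cvg_expR_half.
- by move=> x _; apply: ex_derive; exact: is_derive_expR_half.
- apply: cvg_at_right_filter; apply: cvgN; apply: cvgM; first exact: cvg_cst.
  exact: continuous_expR_half.
- move=> x _; rewrite derive1E.
  by rewrite (@derive_val _ _ _ _ _ _ _ (is_derive_expR_half x)).
Qed.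

Lemma integrable_expR_half :
  mu.-integrable `[(0 : R), +oo[ (EFin \o (fun x : R => expR (- (x / 2)))).
Proof.
apply/integrableP; split.
  apply/measurable_EFinP/measurable_funTS.
  by apply: continuous_measurable_fun; exact: continuous_expR_half.
under eq_integral do rewrite /= ger0_norm ?expR_ge0//.
by rewrite integral_expR_half ltry.
Qed.

Lemma integrable_exp_small f :
  {within `[0, +oo[, continuous f} -> exp_small f ->
  mu.-integrable `[(0 : R), +oo[ (EFin \o f).
Proof.
move=> cf [C h].
apply: (@le_integrable _ _ _ mu `[(0 : R), +oo[ _ _
  (fun x : R => (C * expR (- (x / 2)))%:E)) => //.
- apply/measurable_EFinP.
  apply: subspace_continuous_measurable_fun => //.
- move=> x /=; rewrite in_itv/= andbT => x0.
  by rewrite lee_fin (le_trans (h _ x0))// ler_norm.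
- exact: (integrableZl _ _ integrable_expR_half).
Qed.

(** For a nonnegative integrand this is the fundamental theorem of calculus with
    monotone convergence.  Adding to [f] a multiple of [expR (- (x / 2))] that
    dominates it makes the integrand nonnegative, and the added integral is
    explicit. *)
Lemma Rintegral_deriv_exp_small f F :
  {within `[0, +oo[, continuous f} -> exp_small f -> exp_small F ->
  {for 0, continuous F} -> (forall x : R, 0 < x -> is_derive x 1 F (f x)) ->
  \int[mu]_(x in `[0, +oo[) f x = - F 0.
Proof.
move=> cf sf sF cF dF; have [C h] := sf.
pose e (x : R) := expR (- (x / 2)); pose E (x : R) := - (2 * e x).
have dE (x : R) : 0 < x -> is_derive x 1 (F + C \*: E) (f x + C * e x).
  move=> x0; have ? := dF x x0; have ? := is_derive_expR_half x.
  exact: is_deriveD.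
have sE : exp_small (C \*: E).
  exists (`|C| * 2) => x x0 /=.
  by rewrite normrM normrN normrM (ger0_norm (expR_ge0 _)) (@ger0_norm _ 2)// mulrA.
have ce : {within `[0, +oo[, continuous (fun x => C * e x)}.
  apply: continuous_subspaceT => x; apply: cvgM; first exact: cvg_cst.
  exact: continuous_expR_half.
have se : exp_small (fun x => C * e x).
  by exists `|C| => x x0; rewrite normrM (ger0_norm (expR_ge0 _)).
have := @Rintegral_ge0_continuous_FTC2y R (fun x => f x + C * e x) (F + C \*: E) 0 0.
rewrite RintegralD//; last 2 first.
- exact: integrable_exp_small.
- exact: integrable_exp_small.
rewrite RintegralZl//; last exact: integrable_expR_half.
rewrite {2}/Rintegral integral_expR_half /=.
have F0 : (F + C \*: E) 0 = F 0 - C * 2.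
  have E0 : E 0 = - 2 by rewrite /E /e mul0r oppr0 expR0 mulr1.
  by rewrite /= -mulrN -E0.
have cFE : {for 0, continuous (F + C \*: E)}.
  apply: cvgD => //; apply: (@cvgZl_tmp R R R).
  apply: cvgN; apply: cvgM; first exact: cvg_cst.
  exact: continuous_expR_half.
rewrite F0.
have cancel_tail (a b c : R) : a + b = 0 - (c - b) -> a = - c by lra.
move=> H; apply: cancel_tail; apply: H.
- by move=> x x0; move: (h _ x0); rewrite ler_norml -/(e x) => /andP[]; lra.
- by move=> x; apply: cvgD; [exact: cf|exact: ce].
- by rewrite -(addr0 0); apply: cvgD; exact: exp_small_cvg0.
- by move=> x x0; apply: ex_derive; exact: dE.
- by rewrite -F0; exact: cvg_at_right_filter.
- move=> x; rewrite in_itv/= andbT => x0.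
  by rewrite derive1E (@derive_val _ _ _ _ _ _ _ (dE x x0)).
Qed.

End ExpSmall.

(** * Hermite polynomials and the Gaussian *)

Section Growth.
Context {R : realType}.
Implicit Types (p : {poly R}).

(** The exponential series dominates each monomial: [x ^ k <= k! e ^ x]. *)
Lemma poly_le_expR p :
  exists C : R, forall x, 0 <= x -> `|p.[x]| <= C * expR x.
Proof.
exists (\sum_(i < size p) `|p`_i| * i`!%:R) => x x0.
rewrite horner_coef mulr_suml (le_trans (ler_norm_sum _ _ _))//.
apply: ler_sum => i _; rewrite normrM -mulrA ler_wpM2l//.
rewrite ger0_norm ?exprn_ge0// mulrC -ler_pdivrMr ?ltr0n ?fact_gt0//.
case: (nat_of_ord i) => [|k].
  by rewrite expr0 fact0 divr1 (le_trans _ (expR_ge1Dx x))// lerDl.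
by rewrite (le_trans _ (expR_ge1Dxn k x0))// lerDr.
Qed.

(** Covers both weights of the proof: [u x = x], [v x = x ^ 2 / 2] for the Gaussian
    and [u x = sqrt x], [v x = x] for Gamma. *)
Lemma exp_small_poly_mul p (u v : R -> R) (K : R) :
  (forall x, 0 <= x -> 0 <= u x) ->
  (forall x, 0 <= x -> u x - v x <= K - x / 2) ->
  exp_small (fun x => p.[u x] * expR (- v x)).
Proof.
move=> u0 uv; have [C hC] := poly_le_expR p.
have C0 : 0 <= C.
  have := le_trans (normr_ge0 _) (hC 0 (lexx _)).
  by rewrite pmulr_lge0 ?expR_gt0.
exists (C * expR K) => x x0.
rewrite normrM (ger0_norm (expR_ge0 _)).
rewrite (@le_trans _ _ (C * expR (u x) * expR (- v x)))//.
  by rewrite ler_wpM2r ?expR_ge0// hC// u0.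
by rewrite -!mulrA ler_wpM2l// -!expRD ler_expR uv.
Qed.

Definition gauss (w : R) : R := expR (- (w ^+ 2 / 2)).

Lemma exp_small_poly_gauss p : exp_small (fun w => p.[w] * gauss w).
Proof.
(* 3 w / 2 - w ^ 2 / 2 is maximal at w = 3 / 2 *)
apply: (@exp_small_poly_mul p id (fun w => w ^+ 2 / 2) (9 / 8)) => // x x0.
by rewrite -subr_ge0; have := sqr_ge0 (x - 3 / 2); nra.
Qed.

Lemma is_derive_gauss (w : R) : is_derive w 1 gauss (- w * gauss w).
Proof.
have h : is_derive w 1 (fun y : R => - (y ^+ 2 / 2)) (- w).
  rewrite (_ : (fun y => _) = (- 2^-1) \*: ((@id R) ^+ 2)); last first.
    by apply/funext => y; rewrite /= /GRing.scale /= !fctE; lra.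
  by apply: is_derive_eq; rewrite /GRing.scale/= expr1 mulr1; lra.
have := @is_derive1_comp _ expR _ w _ _ (is_derive_expR _) h.
by move=> /is_derive_eq; apply; rewrite mulrC.
Qed.

Lemma is_derive_poly_gauss p (w : R) :
  is_derive w 1 (fun w => p.[w] * gauss w) ((p^`() - 'X * p).[w] * gauss w).
Proof.
have := @is_deriveM _ _ _ _ _ _ _ _ (is_derive_poly p w) (is_derive_gauss w).
move=> /is_derive_eq; apply.
by rewrite /GRing.scale/= hornerD hornerN hornerM hornerX; ring.
Qed.

Lemma continuous_poly_gauss p : continuous (fun w => p.[w] * gauss w).
Proof.
move=> w; exact: is_derive_continuous (is_derive_poly_gauss p w).
Qed.

(** The recurrence expresses [(H n * g)' = - H n.+1 * g] for the Gaussian [g], so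
    that the Rodrigues formula becomes an induction. *)
Fixpoint hermite_poly (n : nat) : {poly R} :=
  if n is m.+1 then 'X * hermite_poly m - (hermite_poly m)^`() else 1.

Lemma derive1n_gauss n :
  derive1n n gauss = fun w => (-1) ^+ n * ((hermite_poly n).[w] * gauss w).
Proof.
elim: n => [|n IH].
  by apply/funext => w; rewrite /= !hornerE ?mul1r.
apply/funext => w; rewrite derive1nS IH derive1E.
have H := @is_deriveZ _ _ _ _ ((-1) ^+ n) _ _ _
  (is_derive_poly_gauss (hermite_poly n) w).
rewrite (@derive_val _ _ _ _ _ _ _ H) /GRing.scale /= exprS.
by rewrite !(hornerD, hornerN, hornerM, hornerX); ring.
Qed.

Lemma hermite_HeE n w : hermite_He n w = (hermite_poly n).[w].
Proof.
rewrite /hermite_He -/gauss derive1n_gauss.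
rewrite mulrACA -exprMn mulrNN mulr1 expr1n mul1r mulrCA -expRD subrr.
by rewrite expR0 mulr1.
Qed.

(** Differentiating the recurrence [H n.+1 = X H n - H n'] and using the claim for
    [H n] turns [X H n' - H n''] into [n * H n]. *)
Lemma deriv_hermite_poly n :
  (hermite_poly n.+1)^`() = n.+1%:R *: hermite_poly n.
Proof.
elim: n => [|n IH].
  by rewrite /= derivC subr0 mulr1 derivX scale1r.
rewrite [hermite_poly n.+2]/= -/(hermite_poly n.+1) derivB derivM derivX mul1r.
rewrite IH derivZ -scalerAr -addrA -scalerBr.
by rewrite -[X in X + _]scale1r -scalerDl nat1r.
Qed.

Lemma hermite_polySS n :
  hermite_poly n.+2 = 'X * hermite_poly n.+1 - n.+1%:R *: hermite_poly n.
Proof. by rewrite -deriv_hermite_poly. Qed.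

Lemma hermite_poly0_odd l : (hermite_poly l.*2.+1).[0] = 0.
Proof.
elim: l => [|l IH]; first by rewrite /= derivC subr0 mulr1 hornerX.
rewrite doubleS hermite_polySS hornerD hornerN hornerM hornerX hornerZ.
by rewrite IH mul0r mulr0 subr0.
Qed.

Lemma hermite_poly0_even l :
  (hermite_poly l.*2).[0] = (-1) ^+ l * (odd_dfact l)%:R.
Proof.
elim: l => [|l IH]; first by rewrite /= /odd_dfact big_ord0 hornerC mulr1.
rewrite doubleS hermite_polySS hornerD hornerN hornerM hornerX hornerZ.
by rewrite IH /odd_dfact big_ord_recr /= natrM exprS; ring.
Qed.

End Growth.

(** * Integrals of Hermite functions over the half-line *)

Section GaussianIntegrals.
Local Open Scope classical_set_scope.
Context {R : realType}.
Implicit Types (p : {poly R}) (b : R -> R) (t w : R).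
Notation mu := (@lebesgue_measure R).

Lemma exp_small_poly_gauss_bounded p b (B : R) :
  (forall w, `|b w| <= B) -> exp_small (fun w => p.[w] * gauss w * b w).
Proof.
move=> hB; have [C hC] := exp_smallM_bounded _ _ _ hB (exp_small_poly_gauss p).
by exists C => w w0; rewrite mulrC hC.
Qed.

Lemma continuous_poly_gauss_mul p b : continuous b ->
  continuous (fun w => p.[w] * gauss w * b w).
Proof. by move=> cb w; apply: cvgM; [exact: continuous_poly_gauss|exact: cb]. Qed.

Lemma integrable_poly_gauss_bounded p b (B : R) :
  continuous b -> (forall w, `|b w| <= B) ->
  mu.-integrable `[(0 : R), +oo[ (EFin \o (fun w => p.[w] * gauss w * b w)).
Proof.
move=> cb hB; apply: integrable_exp_small.
  exact/continuous_subspaceT/continuous_poly_gauss_mul.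
exact: exp_small_poly_gauss_bounded hB.
Qed.

Lemma integrable_poly_gauss p :
  mu.-integrable `[(0 : R), +oo[ (EFin \o (fun w => p.[w] * gauss w)).
Proof.
apply: integrable_exp_small; last exact: exp_small_poly_gauss.
exact/continuous_subspaceT/continuous_poly_gauss.
Qed.

(** The factor [p^`() - 'X * p] is what differentiating [p] times the Gaussian
    produces.  The bounded factor [b] is a sine or a cosine for the Fourier
    integrals, and the constant 1 for the norms of the Hermite polynomials. *)
Lemma Rintegral_poly_gauss_by_parts p b b' (B B' : R) :
  (forall w, is_derive w 1 b (b' w)) -> continuous b' ->
  (forall w, `|b w| <= B) -> (forall w, `|b' w| <= B') ->
  \int[mu]_(w in `[0, +oo[) ((p^`() - 'X * p).[w] * gauss w * b w)
  = - (p.[0] * b 0) - \int[mu]_(w in `[0, +oo[) (p.[w] * gauss w * b' w).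
Proof.
move=> db cb' hB hB'.
have cb : continuous b.
  by move=> w; exact: is_derive_continuous (db w).
apply/eqP; rewrite -subr_eq opprK; apply/eqP.
rewrite -RintegralD//; [|exact: integrable_poly_gauss_bounded hB
                       |exact: integrable_poly_gauss_bounded hB'].
have g0 : gauss (0 : R) = 1 by rewrite /gauss expr0n mul0r oppr0 expR0.
have := @Rintegral_deriv_exp_small R (fun w => (p^`() - 'X * p).[w] * gauss w * b w
    + p.[w] * gauss w * b' w) (fun w => p.[w] * gauss w * b w).
rewrite g0 mulr1; apply.
- apply: continuous_subspaceT => w.
  by apply: cvgD; exact: continuous_poly_gauss_mul.
- by apply: exp_smallD; [exact: exp_small_poly_gauss_bounded hB|
    exact: exp_small_poly_gauss_bounded hB'].
- exact: exp_small_poly_gauss_bounded hB.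
- exact: continuous_poly_gauss_mul.
- move=> w _; have := @is_deriveM _ _ _ _ _ _ _ _ (is_derive_poly_gauss p w) (db w).
  by move=> /is_derive_eq; apply; rewrite /GRing.scale/=; ring.
Qed.

Lemma hermite_poly_deriv_sub n :
  deriv (@hermite_poly R n) - 'X * hermite_poly n = - hermite_poly n.+1.
Proof. by rewrite opprB. Qed.

Lemma is_derive_cosM t w :
  is_derive w 1 (fun w => cos (t * w)) (- (t * sin (t * w))).
Proof.
have := @is_derive1_comp _ cos _ w _ _ (is_derive_cos _) (is_derive_mulrl t w).
by move=> /is_derive_eq; apply; rewrite mulNr mulrC.
Qed.

Lemma is_derive_sinM t w :
  is_derive w 1 (fun w => sin (t * w)) (t * cos (t * w)).
Proof.
have := @is_derive1_comp _ sin _ w _ _ (is_derive_sin _) (is_derive_mulrl t w).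
by move=> /is_derive_eq; apply; rewrite mulrC.
Qed.

Lemma continuous_cosM t : continuous (fun w => cos (t * w)).
Proof.
move=> w; exact: is_derive_continuous (is_derive_cosM t w).
Qed.

Lemma continuous_sinM t : continuous (fun w => sin (t * w)).
Proof.
move=> w; exact: is_derive_continuous (is_derive_sinM t w).
Qed.

Definition hermite_cos n t :=
  \int[mu]_(w in `[0, +oo[) ((hermite_poly n).[w] * gauss w * cos (t * w)).

Definition hermite_sin n t :=
  \int[mu]_(w in `[0, +oo[) ((hermite_poly n).[w] * gauss w * sin (t * w)).

Lemma norm_cosM_le1 t w : `|cos (t * w)| <= 1.
Proof. by rewrite ler_norml cos_geN1 cos_le1. Qed.

Lemma norm_sinM_le1 t w : `|sin (t * w)| <= 1.
Proof. by rewrite ler_norml sin_geN1 sin_le1. Qed.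

Lemma integrable_hermite_cos n t : mu.-integrable `[(0 : R), +oo[
  (EFin \o (fun w => (hermite_poly n).[w] * gauss w * cos (t * w))).
Proof.
exact: integrable_poly_gauss_bounded (continuous_cosM t) (norm_cosM_le1 t).
Qed.

Lemma integrable_hermite_sin n t : mu.-integrable `[(0 : R), +oo[
  (EFin \o (fun w => (hermite_poly n).[w] * gauss w * sin (t * w))).
Proof.
exact: integrable_poly_gauss_bounded (continuous_sinM t) (norm_sinM_le1 t).
Qed.

Lemma hermite_cosS n t :
  hermite_cos n.+1 t = (hermite_poly n).[0] - t * hermite_sin n t.
Proof.
have cb' : continuous (fun w => - (t * sin (t * w))).
  by move=> w; apply: cvgN; apply: cvgM; [exact: cvg_cst|exact: continuous_sinM].
have hb' w : `|- (t * sin (t * w))| <= `|t|.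
  by rewrite normrN normrM -[leRHS]mulr1 ler_wpM2l// norm_sinM_le1.
have := Rintegral_poly_gauss_by_parts (hermite_poly n) _ _ _ _
  (is_derive_cosM t) cb' (norm_cosM_le1 t) hb'.
rewrite hermite_poly_deriv_sub mulr0 cos0 mulr1.
under eq_Rintegral do rewrite hornerN mulNr mulNr -mulN1r.
rewrite RintegralZl//; last exact: integrable_hermite_cos.
under [in X in _ = _ - X -> _]eq_Rintegral do rewrite -mulNr mulrCA.
rewrite RintegralZl//; last exact: integrable_hermite_sin.
by rewrite -/(hermite_cos _ _) -/(hermite_sin _ _); lra.
Qed.

Lemma hermite_sinS n t : hermite_sin n.+1 t = t * hermite_cos n t.
Proof.
have cb' : continuous (fun w => t * cos (t * w)).
  by move=> w; apply: cvgM; [exact: cvg_cst|exact: continuous_cosM].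
have hb' w : `|t * cos (t * w)| <= `|t|.
  by rewrite normrM -[leRHS]mulr1 ler_wpM2l// norm_cosM_le1.
have := Rintegral_poly_gauss_by_parts (hermite_poly n) _ _ _ _
  (is_derive_sinM t) cb' (norm_sinM_le1 t) hb'.
rewrite hermite_poly_deriv_sub mulr0 sin0 mulr0.
under eq_Rintegral do rewrite hornerN mulNr mulNr -mulN1r.
rewrite RintegralZl//; last exact: integrable_hermite_sin.
under [in X in _ = _ - X -> _]eq_Rintegral do rewrite mulrCA.
rewrite RintegralZl//; last exact: integrable_hermite_cos.
by rewrite -/(hermite_cos _ _) -/(hermite_sin _ _); lra.
Qed.

(** One of two consecutive Hermite polynomials is odd. *)
Lemma hermite_poly0_mulS n :
  (@hermite_poly R n).[0] * (@hermite_poly R n.+1).[0] = 0.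
Proof.
rewrite -[n]odd_double_half; case: (odd n); rewrite ?add1n ?add0n.
  by rewrite hermite_poly0_odd mul0r.
by rewrite hermite_poly0_odd mulr0.
Qed.

(** Rescaling by [sqrt 2] reduces to the integral of [expR (- x ^+ 2)]. *)
Lemma Rintegral_gauss :
  \int[mu]_(w in `[0, +oo[) gauss w = Num.sqrt (pi / 2).
Proof.
pose c : R := (Num.sqrt 2)^-1.
have c0 : 0 < c by rewrite invr_gt0 sqrtr_gt0.
have c2 : c ^+ 2 = 2^-1 by rewrite exprVn sqr_sqrtr.
have dF := is_derive_mulrl c.
have dFE : (fun x : R => c * x)^`() = cst c.
  by apply/funext => w; rewrite derive1E (@derive_val _ _ _ _ _ _ _ (dF w)).
have cF : continuous (fun x : R => c * x).
  by move=> x; apply: cvgM; [exact: cvg_cst|exact: cvg_id].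
have := @increasing_ge0_integration_by_substitutiony R (fun x => c * x) gauss_fun 0.
rewrite mulr0 integral0y_gauss dFE => H.
have {}H : (Num.sqrt pi / 2)%:E = (\int[mu]_(x in `[0%R, +oo[) (c * gauss x)%:E)%E.
  rewrite H.
  - apply: eq_integral => w _; congr EFin.
    rewrite !fctE /= /gauss_fun /gauss exprMn c2 mulrC; congr (_ * expR _).
    by lra.
  - by move=> x y _ _ xy; rewrite ltr_pM2l.
  - by move=> x _; exact: cst_continuous.
  - exact: is_cvg_cst.
  - exact: is_cvg_cst.
  - split.
      by move=> x _; apply: ex_derive; exact: dF.
    by apply: cvg_at_right_filter; exact: cF.
  - exact: gt0_cvgMry.
  - by apply: continuous_subspaceT; exact: continuous_gauss_fun.
  - by move=> x _; exact: gauss_fun_ge0.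
have {}H : Num.sqrt pi / 2 = c * \int[mu]_(w in `[0, +oo[) gauss w.
  rewrite -RintegralZl//; first by rewrite /Rintegral -H.
  have := integrable_poly_gauss 1.
  by apply: eq_integrable => // w _; rewrite /= hornerC mul1r.
have s2 : Num.sqrt 2 != 0 :> R by rewrite gt_eqF// sqrtr_gt0.
rewrite sqrtrM ?pi_ge0// sqrtrV//.
apply: (mulfI (lt0r_neq0 c0)); rewrite -H /c.
by rewrite mulrCA -invfM -expr2 sqr_sqrtr.
Qed.

(** Integrate the derivative of [H n * H n.+1 * g], which is
    [(n + 1) H n ^ 2 * g - H n.+1 ^ 2 * g]; its boundary value at 0 vanishes. *)
Lemma Rintegral_hermite_sqr n :
  \int[mu]_(w in `[0, +oo[) ((hermite_poly n ^+ 2).[w] * gauss w)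
  = n`!%:R * Num.sqrt (pi / 2).
Proof.
elim: n => [|n IH].
  rewrite mul1r -Rintegral_gauss; apply: eq_Rintegral => w _.
  by rewrite /= expr1n hornerC mul1r.
have d1 (w : R) : is_derive w 1 (cst (1 : R)) (cst 0 w) by exact: is_derive_cst.
have n1 (w : R) : `|cst (1 : R) w| <= 1 by rewrite /= normr1.
have n0 (w : R) : `|cst (0 : R) w| <= 0 by rewrite /= normr0.
have := Rintegral_poly_gauss_by_parts (hermite_poly n * hermite_poly n.+1)
  (cst 1) (cst 0) 1 0 d1 (fun x => @cst_continuous _ _ 0 x) n1 n0.
rewrite hornerM hermite_poly0_mulS mul0r.
under [in X in _ = _ - X -> _]eq_Rintegral do rewrite mulr0.
rewrite Rintegral_cst// mul0r !subr0.
have -> : deriv (hermite_poly n * hermite_poly n.+1)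
    - 'X * (hermite_poly n * hermite_poly n.+1)
    = n.+1%:R *: hermite_poly n ^+ 2 - hermite_poly n.+1 ^+ 2 :> {poly R}.
  rewrite derivM deriv_hermite_poly.
  have -> : deriv (hermite_poly n) =
      'X * hermite_poly n - hermite_poly n.+1 :> {poly R}.
    by rewrite /= opprB addrC subrK.
  by rewrite -!mul_polyC; ring.
under eq_Rintegral do rewrite mulr1 hornerD hornerN hornerZ mulrBl -mulrA.
rewrite RintegralB//; last 2 first.
- exact: (integrableZl _ _ (integrable_poly_gauss _)).
- exact: integrable_poly_gauss.
rewrite RintegralZl//; last exact: integrable_poly_gauss.
rewrite IH factS natrM => H; apply/esym/eqP; rewrite -mulrA -subr_eq0 H ?oppr0//.
Qed.

End GaussianIntegrals.

(** * Half-integer values of Gamma *)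

Section GammaHalf.
Local Open Scope classical_set_scope.
Context {R : realType}.
Implicit Types (x : R).
Notation mu := (@lebesgue_measure R).

Lemma exp_small_sqrtX m : exp_small (fun x : R => Num.sqrt x ^+ m * expR (- x)).
Proof.
have [C hC] : exp_small (fun x : R => ('X^m).[Num.sqrt x] * expR (- x)).
  apply: (@exp_small_poly_mul _ _ Num.sqrt id (1 / 2)) => x x0.
    exact: sqrtr_ge0.
  (* sqrt x <= (1 + x) / 2 *)
  by have := sqr_ge0 (Num.sqrt x - 1); rewrite sqrrB1 sqr_sqrtr//; lra.
by exists C => x /hC; rewrite hornerXn.
Qed.

Lemma continuous_sqrtX m : continuous (fun x : R => Num.sqrt x ^+ m * expR (- x)).
Proof.
move=> x; apply: cvgM.
  apply: (@continuous_comp _ _ _ Num.sqrt (fun y => y ^+ m)).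
    exact: sqrt_continuous.
  exact: exprn_continuous.
by apply: continuous_comp; [apply: cvgN; exact: cvg_id|exact: continuous_expR].
Qed.

Lemma integrable_sqrtX m : mu.-integrable `[(0 : R), +oo[
  (EFin \o (fun x : R => Num.sqrt x ^+ m * expR (- x))).
Proof.
apply: integrable_exp_small; last exact: exp_small_sqrtX.
exact/continuous_subspaceT/continuous_sqrtX.
Qed.

(** Powers of [Num.sqrt x] are continuous at 0, and the endpoint has measure 0,
    so the half-line tools apply to Euler's integral. *)
Lemma Gamma_halfE m : Gamma (1 + m%:R / 2 : R) =
  \int[mu]_(x in `[0, +oo[) (Num.sqrt x ^+ m * expR (- x)).
Proof.
rewrite /Gamma -Rintegral_itv_obnd_cbnd; last first.
  apply: integrableS (integrable_sqrtX m) => //.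
  by apply: subset_itvr; rewrite bnd_simp.
apply: eq_Rintegral => x; rewrite inE/= in_itv/= andbT => x0.
rewrite [1 + _]addrC addrK [_ / 2]mulrC powRrM powR12_sqrt ?ltW//.
by rewrite powR_mulrn ?sqrtr_ge0.
Qed.

Lemma is_derive_expRN x : is_derive x 1 (fun y => expR (- y)) (- expR (- x)).
Proof.
have := @is_derive1_comp _ expR _ x _ _ (is_derive_expR _) (is_deriveNid x 1).
by move=> /is_derive_eq; apply; rewrite mulrN1.
Qed.

Lemma is_derive_sqrtX m x : 0 < x ->
  is_derive x 1 (fun y => Num.sqrt y ^+ m.+2) ((1 + m%:R / 2) * Num.sqrt x ^+ m).
Proof.
move=> x0; have s0 : Num.sqrt x != 0 by rewrite gt_eqF// sqrtr_gt0.
rewrite (_ : (fun y => _) = (@Num.sqrt R) ^+ m.+2); last first.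
  by apply/funext => y; rewrite exprfctE.
have := @is_deriveX _ _ _ m.+2 _ _ _ (is_derive1_sqrt x0).
move=> /is_derive_eq; apply.
rewrite /GRing.scale/= exprS invfM -2!natr1.
by move: s0 => /[dup] s0 /mulfV e; field.
Qed.

Lemma Gamma_half_recursion m :
  Gamma (1 + m.+2%:R / 2 : R) = (1 + m%:R / 2) * Gamma (1 + m%:R / 2).
Proof.
rewrite !Gamma_halfE -RintegralZl//; last exact: integrable_sqrtX.
apply/eqP; rewrite -subr_eq0 -RintegralB//; last 2 first.
- exact: integrable_sqrtX.
- exact: (integrableZl _ _ (integrable_sqrtX _)).
have := @Rintegral_deriv_exp_small R
  (fun x => Num.sqrt x ^+ m.+2 * expR (- x) -
    (1 + m%:R / 2) * (Num.sqrt x ^+ m * expR (- x)))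
  (fun x => - (Num.sqrt x ^+ m.+2 * expR (- x))).
rewrite sqrtr0 expr0n mul0r !oppr0 => H; apply/eqP; apply: H.
- apply: continuous_subspaceT => x; apply: cvgB; first exact: continuous_sqrtX.
  by apply: cvgM; [exact: cvg_cst|exact: continuous_sqrtX].
- apply: exp_smallD; first exact: exp_small_sqrtX.
  by apply: exp_smallN; apply: exp_smallZ; exact: exp_small_sqrtX.
- by apply: exp_smallN; exact: exp_small_sqrtX.
- by apply: cvgN; exact: continuous_sqrtX.
- move=> x x0.
  have := @is_deriveM _ _ _ _ _ _ _ _ (is_derive_sqrtX m x x0) (is_derive_expRN x).
  by move=> /is_deriveN /is_derive_eq; apply; rewrite /GRing.scale/=; ring.
Qed.

Lemma Gamma_1 : Gamma (1 + 0%:R / 2 : R) = 1.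
Proof.
rewrite Gamma_halfE.
have := @Rintegral_deriv_exp_small R
  (fun x => Num.sqrt x ^+ 0 * expR (- x))
  (fun x => - (Num.sqrt x ^+ 0 * expR (- x))).
rewrite expr0 mul1r opprK oppr0 expR0; apply.
- exact/continuous_subspaceT/continuous_sqrtX.
- exact: exp_small_sqrtX.
- by apply: exp_smallN; exact: exp_small_sqrtX.
- by apply: cvgN; exact: continuous_sqrtX.
- move=> x x0; rewrite expr0.
  under eq_fun do rewrite mul1r.
  have := is_deriveN (is_derive_expRN x).
  by move=> /is_derive_eq; apply; rewrite opprK mul1r.
Qed.

(** That is, [Gamma (3 / 2) >= 1 / sqrt 2].  The inequality
    [4 sqrt 2 sqrt x >= 6 x - x ^ 2] touches at [x = 2], the choice that makes
    the integrated bound best; its right side integrates to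
    [6 Gamma 2 - Gamma 3 = 4]. *)
Lemma Gamma_3half_lb : 4 <= 4 * Num.sqrt 2 * Gamma (1 + 1%:R / 2 : R).
Proof.
have G2 : Gamma (1 + 2%:R / 2 : R) = 1.
  by rewrite Gamma_half_recursion Gamma_1; lra.
have G4 : Gamma (1 + 4%:R / 2 : R) = 2.
  by rewrite Gamma_half_recursion G2; lra.
suff : 6 * Gamma (1 + 2%:R / 2) - Gamma (1 + 4%:R / 2)
    <= 4 * Num.sqrt 2 * Gamma (1 + 1%:R / 2 : R) by rewrite G2 G4; lra.
rewrite !Gamma_halfE -!RintegralZl//; try exact: integrable_sqrtX.
have iZ (a : R) k : mu.-integrable `[(0 : R), +oo[
    (EFin \o (fun x => a * (Num.sqrt x ^+ k * expR (- x)))).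
  exact: (integrableZl _ _ (integrable_sqrtX k)).
rewrite -RintegralB//; last exact: integrable_sqrtX.
apply: le_Rintegral => //; [|move=> x _].
  exact: (integrableB _ (iZ _ _) (integrable_sqrtX _)).
rewrite [6 * _]mulrA [_ * Num.sqrt 2 * _]mulrA -mulrBl ler_wpM2r ?expR_ge0//.
set s := Num.sqrt x; set r := Num.sqrt 2.
have r2 : r ^+ 2 = 2 by rewrite sqr_sqrtr.
rewrite -subr_ge0.
have -> : 4 * r * s ^+ 1 - (6 * s ^+ 2 - s ^+ 4) = s * ((s - r) ^+ 2 * (s + 2 * r)).
  transitivity (s * (s ^+ 3 - 3 * r ^+ 2 * s + 2 * r * r ^+ 2)); last by ring.
  by rewrite r2; ring.
apply: mulr_ge0; first exact: sqrtr_ge0.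
apply: mulr_ge0; first exact: sqr_ge0.
by apply: addr_ge0; [|apply: mulr_ge0 => //]; exact: sqrtr_ge0.
Qed.

(** In steps of 2 the functional equation of Gamma reduces the claim to
    [(m + 1) (m + 2) <= (m + 2) ^ 2]. *)
Lemma fact_le_Gamma_sqr m :
  m`!%:R <= (2 `^ (m%:R / 2) * Gamma (1 + m%:R / 2 : R)) ^+ 2.
Proof.
have pow2 k : (2 `^ (k%:R / 2) : R) ^+ 2 = 2 ^+ k.
  by rewrite powRrM powR12_sqrt ?powR_ge0// sqr_sqrtr ?powR_ge0// powR_mulrn.
rewrite exprMn pow2.
elim/ltn_ind: m => -[|[|m]] IH.
- by rewrite Gamma_1 expr1n mulr1.
- have := Gamma_3half_lb; set g := Gamma _ => H.
  have s : Num.sqrt 2 ^+ 2 = 2 :> R by rewrite sqr_sqrtr.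
  have {}H : 1 <= Num.sqrt 2 * g by lra.
  have := ler_pM ler01 ler01 H H.
  by rewrite mulrACA -!expr2 s expr1n.
rewrite Gamma_half_recursion !factS !natrM exprMn.
have := IH m (ltnW (ltnSn _)); set f := _`!%:R; set g := Gamma _ ^+ 2 => H.
have m0 : 0 <= m%:R :> R by [].
rewrite -2!natr1 2!exprS.
have g0 : 0 <= 2 ^+ m * g by apply: mulr_ge0; [exact: exprn_ge0|exact: sqr_ge0].
have -> : 2 * (2 * 2 ^+ m) * ((1 + m%:R / 2) ^+ 2 * g) =
    (m%:R + 2) ^+ 2 * (2 ^+ m * g).
  by field.
rewrite -[m%:R + 1 + 1]addrA.
rewrite mulrA; apply: ler_pM => //; nra.
Qed.

End GammaHalf.

(** * The remainder *)

Section Remainder.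
Local Open Scope complex_scope.
Context {R : realType}.
Implicit Types (t : R) (n M l : nat).
Notation mu := (@lebesgue_measure R).

Lemma hermite_integralE n t :
  hermite_integral n t = hermite_cos n t +i* hermite_sin n t.
Proof.
rewrite /hermite_integral /cintegral; congr (_ +i* _);
  apply: eq_Rintegral => w _;
  rewrite /cexp /= !(mul0r, mulr0, mul1r, subr0, addr0, add0r) hermite_HeE;
  by rewrite oppr0 mul0r expR0 mul1r.
Qed.

(** The two real recurrences for the cosine and sine parts, read as one complex
    identity. *)
Lemma hermite_integralS n t : hermite_integral n.+1 t =
  (hermite_poly n).[0]%:C + 'i * t%:C * hermite_integral n t.
Proof.
rewrite !hermite_integralE hermite_cosS hermite_sinS.
by simpc.
Qed.

(** By induction on [M]: each application of [hermite_integralS] raises the index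
    of the integral by one at the cost of the boundary term
    [H M (0) / (i t) ^ (M - n + 1)], which is the next term of the sum when [M] is
    even and zero when [M] is odd. *)
Lemma hermite_remainder_eq n M t : (n < M)%N -> t != 0 ->
  hermite_remainder n M t = hermite_integral M t / ('i * t%:C) ^+ (M - n).
Proof.
move=> nM t0; rewrite /hermite_remainder.
have i0 : ('i : R[i]) != 0 by rewrite eq_complex /= oner_eq0 andbF.
have tC0 : t%:C != 0 by rewrite eq_complex /= eqxx andbT.
have it0 : 'i * t%:C != 0 by rewrite mulf_neq0.
(* In this form the sum is empty for [M = n], where the induction starts,
   also when [n = 0]. *)
have -> : (M.-1)./2.+1 = uphalf M by case: M nM.
elim: M nM => // M IH; rewrite ltnS => nM.
have {}IH : hermite_integral n t + 'i ^ (n%:Z - 1) *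
    (\sum_(uphalf n <= l < uphalf M) (odd_dfact l)%:R / t ^+ (l.*2 - n + 1))%:C
    = hermite_integral M t / ('i * t%:C) ^+ (M - n).
  move: nM; rewrite leq_eqVlt => /predU1P[<-|/IH//].
  by rewrite big_geq// mulr0 addr0 subnn expr0 divr1.
rewrite subSn// exprS hermite_integralS.
have -> : (((hermite_poly M).[0])%:C + 'i * t%:C * hermite_integral M t) /
    ('i * t%:C * ('i * t%:C) ^+ (M - n)) =
    hermite_integral M t / ('i * t%:C) ^+ (M - n) +
     ((hermite_poly M).[0])%:C / ('i * t%:C) ^+ (M - n).+1.
  rewrite exprS; have : ('i * t%:C) ^+ (M - n) != 0 by rewrite expf_neq0.
  by move: it0; set z := 'i * _; set y := z ^+ _; move=> z0 y0; field; apply/andP.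
rewrite -IH.
have [oM|eM] := boolP (odd M).
  have e : M = M./2.*2.+1 by rewrite -[LHS]odd_double_half oM.
  have -> : uphalf M.+1 = uphalf M by rewrite uphalfE /= uphalf_half oM.
  by rewrite e hermite_poly0_odd mul0r addr0.
have e : M = M./2.*2 by rewrite -[LHS]odd_double_half (negbTE eM).
set k := M./2 in e.
have u1 : uphalf M.+1 = k.+1 by rewrite e /= doubleK.
have u2 : uphalf M = k by rewrite e uphalf_double.
rewrite u1 u2 big_nat_recr /=; last first.
  by rewrite -(uphalf_double k) -e uphalf_leq.
rewrite rmorphD mulrDr addrA; congr (_ + _).
have H0 : (@hermite_poly R M).[0] = (-1) ^+ k * (odd_dfact k)%:R.
  by rewrite {1}e hermite_poly0_even.
have ik : 'i ^ (n%:Z - 1) * 'i ^+ (M - n).+1 = ((-1) ^+ k)%:C :> R[i].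
  rewrite -[_ ^+ _]/('i ^ (M - n).+1%:Z) -expfzDr//.
  have -> : n%:Z - 1 + (M - n).+1%:Z = M%:Z by lia.
  by rewrite -exprnP e -mul2n exprM sqr_i rmorphXn rmorphN1.
rewrite H0 -e addn1 !rmorphM /= -ik exprMn fmorphV /= rmorphXn /=.
have : ('i : R[i]) ^+ (M - n).+1 != 0 by rewrite expf_neq0.
have : t%:C ^+ (M - n).+1 != 0 by rewrite expf_neq0.
set a := _ ^+ _.+1; set b := 'i ^+ _; move=> a0 b0.
by field; apply/andP.
Qed.

(** For a complex integral [A + i B] of modulus [r], the number [r ^ 2] is the
    integral of [(A cos + B sin) H g], whose trigonometric factor is at most [r].
    The remaining factor [|H|] is bounded by [(H ^ 2 / c + c) / 2]; the choice
    [c = sqrt n!] balances the two resulting integrals and yields the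
    Cauchy-Schwarz bound. *)
Lemma norm_hermite_integral_le n t :
  `|hermite_integral n t| <= (Num.sqrt (pi / 2) * Num.sqrt (n`!%:R))%:C.
Proof.
rewrite hermite_integralE normc_def lecR /=.
set A := hermite_cos n t; set B := hermite_sin n t.
set r := Num.sqrt _.
have r2 : r ^+ 2 = A ^+ 2 + B ^+ 2 by rewrite sqr_sqrtr// addr_ge0// sqr_ge0.
have r0 : 0 <= r by exact: sqrtr_ge0.
have [->|rN0] := eqVneq r 0; first by rewrite mulr_ge0 ?sqrtr_ge0.
have {rN0} rp : 0 < r by rewrite lt0r rN0.
rewrite -(ler_pM2l rp) -expr2 r2.
pose c := Num.sqrt n`!%:R : R.
have cp : 0 < c by rewrite sqrtr_gt0 ltr0n fact_gt0.
have cN0 := lt0r_neq0 cp.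
have c2 : c ^+ 2 = n`!%:R by rewrite sqr_sqrtr.
pose D := (`[0, +oo[%classic : set R).
have mD : measurable D by exact: measurable_itv.
pose h (w : R) := (hermite_poly n).[w] * gauss w.
have iC (a : R) : mu.-integrable D (EFin \o (fun w => a * (h w * cos (t * w)))).
  exact: (integrableZl _ _ (integrable_hermite_cos n t)).
have iS (a : R) : mu.-integrable D (EFin \o (fun w => a * (h w * sin (t * w)))).
  exact: (integrableZl _ _ (integrable_hermite_sin n t)).
have iH (a : R) : mu.-integrable D
    (EFin \o (fun w => a * ((hermite_poly n ^+ 2).[w] * gauss w))).
  exact: (integrableZl _ _ (integrable_poly_gauss _)).
have iG (a : R) : mu.-integrable D
    (EFin \o (fun w => a * ((1 : {poly R}).[w] * gauss w))).
  exact: (integrableZl _ _ (integrable_poly_gauss _)).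
have G1 : (\int[mu]_(w in D) ((1 : {poly R}).[w] * gauss w)) = Num.sqrt (pi / 2).
  by rewrite -Rintegral_gauss; apply: eq_Rintegral => w _; rewrite hornerC mul1r.
have -> : A ^+ 2 + B ^+ 2 =
    \int[mu]_(w in D) (A * (h w * cos (t * w)) + B * (h w * sin (t * w))).
  rewrite RintegralD// !RintegralZl//.
    exact: integrable_hermite_sin.
  exact: integrable_hermite_cos.
have -> : r * (Num.sqrt (pi / 2) * Num.sqrt n`!%:R) =
    \int[mu]_(w in D) (r / (2 * c) * ((hermite_poly n ^+ 2).[w] * gauss w) +
                       r * c / 2 * ((1 : {poly R}).[w] * gauss w)).
  rewrite RintegralD// !RintegralZl//; try exact: integrable_poly_gauss.
  rewrite G1 Rintegral_hermite_sqr -/c -c2.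
  by field.
apply: le_Rintegral => //.
- exact: (integrableD _ (iC _) (iS _)).
- exact: (integrableD _ (iH _) (iG _)).
move=> w _; rewrite hornerC horner_exp /h mul1r.
set H := (hermite_poly n).[w]; set g := gauss w.
set x := cos _; set y := sin _.
have -> : A * (H * g * x) + B * (H * g * y) = (A * x + B * y) * H * g by ring.
have -> : r / (2 * c) * (H ^+ 2 * g) + r * c / 2 * g =
    (r / (2 * c) * H ^+ 2 + r * c / 2) * g.
  by ring.
rewrite ler_wpM2r ?expR_ge0//.
have xy : x ^+ 2 + y ^+ 2 = 1 by exact: cos2Dsin2.
have CS : `|A * x + B * y| <= r.
  rewrite -sqrtr_sqr ler_wsqrtr//.
  rewrite -subr_ge0.
  have -> : A ^+ 2 + B ^+ 2 - (A * x + B * y) ^+ 2 = (A * y - B * x) ^+ 2.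
    by rewrite -[A ^+ 2 + B ^+ 2]mulr1 -xy; ring.
  exact: sqr_ge0.
rewrite (le_trans (ler_norm _))// normrM.
rewrite (@le_trans _ _ (r * `|H|))// ?ler_wpM2r//.
rewrite -(real_normK (num_real H)).
have -> : r / (2 * c) * `|H| ^+ 2 + r * c / 2 =
    r * (`|H| ^+ 2 / (2 * c) + c / 2) by field.
rewrite ler_wpM2l// -subr_ge0.
have -> : `|H| ^+ 2 / (2 * c) + c / 2 - `|H| =
    (`|H| - c) ^+ 2 / (2 * c) by field.
by rewrite divr_ge0 ?sqr_ge0// mulr_ge0// ltW.
Qed.

End Remainder.

Local Open Scope complex_scope.

Theorem lemma2 (R : realType) (n M : nat) (t : R) (hnM : (n < M)%N)
    (ht : 0 < t) :
  `|hermite_remainder n M t| <=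
    (Num.sqrt (pi / 2) * (t ^+ (M - n))^-1 * 2 `^ (M%:R / 2) *
      Gamma (1 + M%:R / 2))%:C.
Proof.
rewrite hermite_remainder_eq// ?gt_eqF// normrM normfV normrX normrM.
have -> : `|'i| = 1 :> R[i] by rewrite normc_def /= expr0n expr1n add0r sqrtr1.
have -> : `|t%:C| = t%:C by rewrite normc_def /= expr0n addr0 sqrtr_sqr gtr0_norm.
rewrite mul1r -mulrA [_ * _ * (_ * _)]mulrAC rmorphM fmorphV rmorphXn.
rewrite ler_wpM2r ?invr_ge0 ?exprn_ge0//; first by rewrite lecR ltW.
apply: le_trans (norm_hermite_integral_le _ _) _; rewrite lecR.
rewrite ler_wpM2l ?sqrtr_ge0//.
rewrite -[leRHS]ger0_norm; last first.
  apply: mulr_ge0; first exact: powR_ge0.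
  rewrite Gamma_halfE; apply: Rintegral_ge0 => x _.
  by rewrite mulr_ge0 ?expR_ge0 ?exprn_ge0 ?sqrtr_ge0.
by rewrite -sqrtr_sqr ler_wsqrtr// fact_le_Gamma_sqr.
Qed.
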